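(* Let $\mathcal{G}$ be a nonempty finite family of connected graphs with common vertex set $V$ that have a shortest path of length $d$ in common; that is, there are vertices $v_0,v_1,\dots,v_d\in V$ such that for every $G\in\mathcal{G}$ the sequence $v_0,v_1,\dots,v_d$ is a shortest path in $G$ from $v_0$ to $v_d$. Then $$\operatorname{Sd}(\mathcal{G})\le |V|-d.$$
   Context: All graphs are finite and simple. For a connected graph $G=(V,E)$, $d_G(x,y)$ denotes the length of a shortest path between $x$ and $y$ in $G$. A vertex $v$ resolves two vertices $x,y$ if $d_G(v,x)\ne d_G(v,y)$. A set $S\subseteq V$ is a metric generator for $G$ if every pair of distinct vertices of $G$ is resolved by some element of $S$. For a finite family $\mathcal{G}$ of connected graphs on a common vertex set $V$, a simultaneous metric generator for $\mathcal{G}$ is a set $S\subseteq V$ that is a metric generator for every graph in $\mathcal{G}$; the simultaneous metric dimension $\operatorname{Sd}(\mathcal{G})$ is the minimum cardinality of a simultaneous metric generator for $\mathcal{G}$. *)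

(* Defs.v *)
From mathcomp Require Import all_boot.

Set Implicit Arguments.
Unset Strict Implicit.
Unset Printing Implicit Defensive.

Record sgraph (V : finType) := SGraph {
  sedge :> rel V;
  sgraph_sym : symmetric sedge;
  sgraph_irr : irreflexive sedge }.

Section Graph.
Variables (V : finType) (G : sgraph V).

Definition connected_graph := forall x y : V, connect G x y.

(* The vertex sequence x :: p is a path of length size p from x to y. *)
Definition is_path (x y : V) (p : seq V) :=
  [&& path G x p, last x p == y & uniq (x :: p)].

(* A path has fewer than #|V| edges, so the search range is exhaustive; the
   value is #|V| when x and y lie in different components. *)
Definition dist (x y : V) : nat :=
  find (fun n => [exists p : n.-tuple V, is_path x y p]) (iota 0 #|V|).

Definition is_shortest_path (x y : V) (p : seq V) :=
  is_path x y p && (size p == dist x y).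

Definition resolves (v x y : V) := dist v x != dist v y.

Definition metric_generator (S : {set V}) :=
  [forall x, forall y, (x != y) ==> [exists v in S, resolves v x y]].

Lemma is_path_size x y p : is_path x y p -> size p < #|V|.
Proof. by case/and3P=> _ _ /card_uniqP /= <-; apply: max_card. Qed.

Lemma dist_le x y p : is_path x y p -> dist x y <= size p.
Proof.
move=> xpy; rewrite leqNgt; apply/negP => /(before_find 0).
rewrite nth_iota ?(is_path_size xpy) // add0n.
by move/existsP; case; exists (in_tuple p).
Qed.

Lemma dist_path x y : connect G x y ->
  exists2 p, is_path x y p & size p = dist x y.
Proof.
case/connectP=> p xp ->; case: (shortenP xp) => q xq uq _.
have xqy : is_path x (last x q) q by rewrite /is_path xq eqxx uq.
have lt_d : dist x (last x q) < #|V|.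
  exact: leq_ltn_trans (dist_le xqy) (is_path_size xqy).
have := lt_d; rewrite -[X in _ < X](size_iota 0) -has_find.
move/(nth_find 0); rewrite nth_iota // add0n => /existsP[r xry].
by exists r; rewrite // size_tuple.
Qed.

Lemma dist_eq0 x y : (dist x y == 0) = (x == y).
Proof.
apply/eqP/eqP => [d0 | <-]; last first.
  by apply/eqP; rewrite -leqn0 (@dist_le _ _ [::]) // /is_path /= eqxx.
have V_gt0 : 0 < #|V| by apply/card_gt0P; exists x.
have : has (fun n => [exists p : n.-tuple V, is_path x y p]) (iota 0 #|V|).
  by rewrite has_find size_iota -/(dist x y) d0.
move/(nth_find 0); rewrite -/(dist x y) d0 nth_iota //.
by case/existsP=> p; rewrite tuple0 /is_path /= andbT => /eqP.
Qed.

Lemma metric_generatorT : metric_generator setT.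
Proof.
apply/forallP=> x; apply/forallP=> y; apply/implyP=> neq_xy.
apply/existsP; exists x; rewrite inE /resolves /=.
have /eqP-> : dist x x == 0 by rewrite dist_eq0.
by rewrite eq_sym dist_eq0.
Qed.

End Graph.

Section Family.
Variables (V I : finType) (G : I -> sgraph V).

Definition sim_metric_generator (S : {set V}) :=
  [forall i, metric_generator (G i) S].

Lemma sim_metric_generatorT : sim_metric_generator setT.
Proof. by apply/forallP=> i; apply: metric_generatorT. Qed.

(* The minimum is attained: by sim_metric_generatorT, the seed setT of the
   search is itself a simultaneous metric generator. *)
Definition Sd : nat :=
  #|[arg min_(S < [set: V] | sim_metric_generator S) #|S|]|.

End Family.

(* Main.v *)
Require Import Defs.
From mathcomp Require Import all_boot.

Set Implicit Arguments.
Unset Strict Implicit.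
Unset Printing Implicit Defensive.

(** Vertices of a shortest path starting at [v0] lie at pairwise different
    distances from [v0] ([dist_shortest_path]), so [v0] alone resolves every
    pair of them.  Any other pair has an end off the path [v1, ..., vd], and a
    vertex resolves each pair that it belongs to.  Hence the complement of
    [{v1, ..., vd}], which contains [v0], generates every graph in which
    [v0, v1, ..., vd] is a shortest path; it has [#|V| - d] elements. *)

Section ShortestPath.
Variables (V : finType) (G : sgraph V).

(** Cutting the loops out of a walk does not lengthen it; this is what makes
    distances comparable with concatenations of paths, which may repeat
    vertices. *)
Lemma dist_le_walk x p : path G x p -> dist G x (last x p) <= size p.
Proof.
case/shortenP=> q xq uq sub_qp.
have xqy : is_path G x (last x q) q by rewrite /is_path xq eqxx uq.
apply: leq_trans (dist_le xqy) _; apply: uniq_leq_size => //.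
by case/andP: uq.
Qed.

(** A shorter route to the end of [p1], followed by [p2], would be a walk
    shorter than the whole path. *)
Lemma dist_shortest_prefix x y p1 p2 :
  is_shortest_path G x y (p1 ++ p2) -> dist G x (last x p1) = size p1.
Proof.
case/andP=> /and3P[]; rewrite cat_path last_cat => /andP[xp1 p1p2] /eqP <- _.
move/eqP=> size_p; apply/eqP; rewrite eqn_leq dist_le_walk //=.
have /dist_path[q /and3P[xq /eqP lq _] <-] : connect G x (last x p1).
  by apply/connectP; exists p1.
have : path G x (q ++ p2) by rewrite cat_path xq lq.
by move/dist_le_walk; rewrite last_cat lq -size_p !size_cat leq_add2r.
Qed.

Lemma dist_shortest_path x y p z :
  is_shortest_path G x y p -> z \in x :: p -> dist G x z = index z (x :: p).
Proof.
move=> shp /splitPl p_z; case: p_z shp => p1 p2 <- shp.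
rewrite (dist_shortest_prefix shp).
have /andP[/and3P[_ _ uniq_p] _] := shp.
rewrite (last_nth x) -[nth x _ _](_ : nth x (x :: p1 ++ p2) (size p1) = _).
  by rewrite index_uniq //= size_cat ltnS leq_addr.
by rewrite -cat_cons nth_cat /= ltnSn.
Qed.

Lemma resolves_self x y : x != y -> resolves G x x y.
Proof.
move=> neq_xy; have /eqP d0 : dist G x x == 0 by rewrite dist_eq0.
by rewrite /resolves d0 eq_sym dist_eq0.
Qed.

Lemma resolves_end x y : x != y -> resolves G y x y.
Proof. by rewrite eq_sym => /resolves_self; rewrite /resolves eq_sym. Qed.

Lemma metric_generator_setC_path x y p :
  is_shortest_path G x y p -> metric_generator G (~: [set z in p]).
Proof.
move=> shp; have /andP[/and3P[_ _ /= /andP[x_notin_p _]] _] := shp.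
apply/forallP=> u; apply/forallP=> v; apply/implyP=> neq_uv; apply/existsP.
have [u_in_p | u_notin_p] := boolP (u \in p); last first.
  by exists u; rewrite !inE u_notin_p resolves_self.
have [v_in_p | v_notin_p] := boolP (v \in p); last first.
  by exists v; rewrite !inE v_notin_p resolves_end.
have [u_in v_in] : u \in x :: p /\ v \in x :: p.
  by rewrite !inE u_in_p v_in_p !orbT.
exists x; rewrite !inE x_notin_p /resolves !(dist_shortest_path shp) //.
by apply: contra neq_uv => /eqP/(index_inj x u_in v_in) ->.
Qed.

End ShortestPath.

Lemma Sd_le_card (V I : finType) (G : I -> sgraph V) (S : {set V}) :
  sim_metric_generator G S -> Sd G <= #|S|.
Proof.
move=> genS; rewrite /Sd; case: arg_minnP => [|T _ minT].
  exact: sim_metric_generatorT.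
exact: minT.
Qed.

Theorem theorem2p5 (V I : finType) (G : I -> sgraph V)
    (I_nonempty : 0 < #|I|)
    (G_connected : forall i : I, connected_graph (G i))
    (d : nat) (v0 : V) (p : d.-tuple V)
    (common_path : forall i : I, is_shortest_path (G i) v0 (last v0 p) p) :
  Sd G <= #|V| - d.
Proof.
have uniq_p : uniq p.
  have /card_gt0P[i _] := I_nonempty.
  by have /andP[/and3P[_ _ /andP[]]] := common_path i.
have genS : sim_metric_generator G (~: [set z in p]).
  by apply/forallP=> i; apply: metric_generator_setC_path (common_path i).
apply: leq_trans (Sd_le_card genS) _.
by rewrite cardsCs setCK cardsE (card_uniqP uniq_p) size_tuple.
Qed.
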